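(* Let $(X,T)$ be a topological dynamical system. Then: (1) If $(K(X),T_K)$ is weakly mixing and is disjoint from all minimal systems, then $(X,T)$ is weakly mixing and is disjoint from all minimal systems. (2) If $(X,T)$ is strongly disjoint from all minimal systems, then both $(K(X),T_K)$ and $(M(X),T_M)$ are disjoint from all minimal systems.
   Context: A topological dynamical system (t.d.s.) is a pair $(X,T)$ with $X$ a compact metric space and $T:X\to X$ a continuous surjective map. $\mathbb{N}=\{1,2,\dots\}$ and $\mathbb{Z}_+=\mathbb{N}\cup\{0\}$. $K(X)$ is the space of non-empty closed subsets of $X$ with the Hausdorff metric (a compact metric space), and $T_K:K(X)\to K(X)$, $T_K(C)=TC$. $M(X)$ is the space of Borel probability measures on $X$ with the weak$^*$-topology, and $T_M:M(X)\to M(X)$, $(T_M\mu)(A)=\mu(T^{-1}A)$ for Borel $A\subset X$. Both $(K(X),T_K)$ and $(M(X),T_M)$ are t.d.s. $(X,T)$ is transitive if for all non-empty open $U,V\subset X$ the set $\{n\in\mathbb{Z}_+: T^{-n}V\cap U\ne\emptyset\}$ is infinite, and weakly mixing if $(X\times X,T\times T)$ is transitive. $(X,T)$ is minimal if every orbit $\{x,Tx,T^2x,\dots\}$, $x\in X$, is dense in $X$. A joining of t.d.s. $(X,T)$ and $(Y,S)$ is a non-empty closed set $J\subset X\times Y$ that is invariant ($(T\times S)J\subset J$) and projects onto $X$ and onto $Y$. $(X,T)$ and $(Y,S)$ are disjoint if $X\times Y$ is their only joining. $(X,T)$ is disjoint from all minimal systems if it is disjoint from every minimal t.d.s. $(Y,S)$.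 $(X,T)$ is strongly disjoint from all minimal systems if for every $n\in\mathbb{N}$ the $n$-fold product system $(X^n,T^{(n)})$, $T^{(n)}=T\times\cdots\times T$, is disjoint from all minimal systems. *)

(* Defs.v *)
From HB Require Import structures.
From mathcomp Require Import all_boot all_order all_algebra.
From mathcomp Require Import all_classical all_reals all_analysis.

Set Implicit Arguments.
Unset Strict Implicit.
Unset Printing Implicit Defensive.

Import Order.TTheory GRing.Theory Num.Theory.
Import numFieldNormedType.Exports.

Local Open Scope classical_set_scope.
Local Open Scope ring_scope.

(** The dynamical notions below only involve the topology of the phase space,
    so they are stated for a self-map of an arbitrary topological space. *)
Section dynamics.
Context {X : topologicalType} (T : X -> X).

Definition transitive_map : Prop :=
  forall U V : set X, open U -> U !=set0 -> open V -> V !=set0 ->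
    infinite_set [set n : nat | (iter n T @^-1` V) `&` U !=set0].

Definition minimal_map : Prop :=
  forall x : X, dense (range (fun n : nat => iter n T x)).

End dynamics.

Section products.
Context {X Y : topologicalType} (T : X -> X) (S : Y -> Y).

Definition prod_map (p : X * Y) : X * Y := (T p.1, S p.2).

Definition joining (J : set (X * Y)) : Prop :=
  [/\ J !=set0, closed J, prod_map @` J `<=` J,
      fst @` J = [set: X] & snd @` J = [set: Y]].

Definition disjoint_maps : Prop :=
  forall J : set (X * Y), joining J <-> J = [set: X * Y].

Definition power_map (n : nat) (x : {ptws 'I_n -> X}) : {ptws 'I_n -> X} :=
  fun i => T (x i).

End products.

Definition weakly_mixing_map (X : topologicalType) (T : X -> X) : Prop :=
  transitive_map (prod_map T T).

Record tds (R : realType) := TDS {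
  tds_space :> metricType R ;
  tds_map : tds_space -> tds_space ;
  tds_nonempty : [set: tds_space] !=set0 ;
  tds_compact : compact [set: tds_space] ;
  tds_continuous : continuous tds_map ;
  tds_surjective : range tds_map = [set: tds_space] }.

Definition disjoint_from_minimal (R : realType) (X : topologicalType)
    (T : X -> X) : Prop :=
  forall Y : tds R, minimal_map (@tds_map R Y) ->
    disjoint_maps T (@tds_map R Y).

Definition strongly_disjoint_from_minimal (R : realType) (X : topologicalType)
    (T : X -> X) : Prop :=
  forall n : nat, (0 < n)%N -> disjoint_from_minimal R (@power_map X T n).

Section hyperspace.
Context {R : realType} (X : tds R).

Record hyperspace := Hyperspace {
  hset :> set X ;
  hset_closed : closed hset ;
  hset_nonempty : hset !=set0 }.

HB.instance Definition _ := gen_eqMixin hyperspace.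
HB.instance Definition _ := gen_choiceMixin hyperspace.

Lemma hyperspace_ext (A B : hyperspace) : hset A = hset B -> A = B.
Proof.
case: A B => [A cA nA] [B cB nB] /= AB; move: cA nA; rewrite AB => cA nA.
by congr Hyperspace; exact: Prop_irrelevance.
Qed.

Definition setdist (x : X) (A : set X) : R := inf [set mdist x a | a in A].

Definition excess (A B : set X) : R := sup [set setdist a B | a in A].

Definition hausdorff_dist (A B : hyperspace) : R :=
  Num.max (excess A B) (excess B A).

Let mdist_bounded : exists M : R, forall x y : X, mdist x y <= M.
Proof.
have [p _] := tds_nonempty X.
have /compact_near_coveringP/(_ nat \oo (fun n x => mdist p x <= n%:R) _) :=
  @tds_compact R X.
case=> [x _|n _ /(_ n (leqnn n)) pn].
  near=> y n => /=.
  have yx : mdist x y < 1.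
    near: y; have := nbhsx_ballx x _ (@ltr01 R).
    by rewrite ballEmdist.
  apply: le_trans (metric_triangle p x y) _.
  apply: (@le_trans _ _ (mdist p x + 1)); first by rewrite lerD2l ltW.
  by near: n; exact: nbhs_infty_ger.
exists (n%:R + n%:R) => x y; apply: le_trans (metric_triangle x p y) _.
by rewrite lerD ?(metric_sym x) ?pn.
Unshelve. all: by end_near. Qed.

Let setdist_lb x (A : set X) : has_lbound [set mdist x a | a in A].
Proof. by exists 0 => _ [a _ <-]; exact: mdist_ge0. Qed.

Let setdist_le x a (A : set X) : A a -> setdist x A <= mdist x a.
Proof. by move=> Aa; apply: ge_inf => //; exists a. Qed.

Let setdist_ge0 x (A : hyperspace) : 0 <= setdist x A.
Proof.
apply: lb_le_inf => [|_ [a _ <-]]; last exact: mdist_ge0.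
by have [a Aa] := hset_nonempty A; exists (mdist x a), a.
Qed.

Let excess_ub (A B : hyperspace) : has_ubound [set setdist a B | a in A].
Proof.
have [M xyM] := mdist_bounded; have [b Bb] := hset_nonempty B.
by exists M => _ [a _ <-]; apply: le_trans (setdist_le a Bb) (xyM _ _).
Qed.

Let le_excess (A B : hyperspace) a : hset A a -> setdist a B <= excess A B.
Proof. by move=> Aa; apply: ub_le_sup; [exact: excess_ub|exists a]. Qed.

Let excess_le (A B : hyperspace) r :
  (forall a, hset A a -> setdist a B <= r) -> excess A B <= r.
Proof.
move=> ABr; apply: ge_sup => [|_ [a Aa <-]]; last exact: ABr.
by have [a Aa] := hset_nonempty A; exists (setdist a B), a.
Qed.

Let excess_ge0 (A B : hyperspace) : 0 <= excess A B.
Proof.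
have [a Aa] := hset_nonempty A.
exact: le_trans (setdist_ge0 a B) (le_excess B Aa).
Qed.

Let excessxx (A : hyperspace) : excess A A = 0.
Proof.
apply/eqP; rewrite eq_le excess_ge0 andbT; apply: excess_le => a Aa.
by rewrite -(mdistxx a) setdist_le.
Qed.

Let excess0 (A B : hyperspace) : excess A B <= 0 -> hset A `<=` B.
Proof.
move=> AB0 a Aa; apply: (hset_closed (h := B)) => V.
rewrite -nbhs_ballE => -[e /= e0 eV].
have : setdist a B < e := le_lt_trans (le_trans (le_excess B Aa) AB0) e0.
move=> /inf_lt[|_ [b Bb <-] abe].
  by have [b Bb] := hset_nonempty B; exists (mdist a b), b.
by exists b; split=> //; apply: eV; rewrite ballEmdist.
Qed.

Let excess_triangle (B A C : hyperspace) :
  excess A C <= excess A B + excess B C.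
Proof.
apply: excess_le => a Aa; apply/ler_addgt0Pr => e e0.
have : setdist a B < excess A B + e.
  by rewrite (le_lt_trans (le_excess B Aa))// ltrDl.
move=> /inf_lt[|_ [b Bb <-] abe].
  by have [b Bb] := hset_nonempty B; exists (mdist a b), b.
rewrite addrAC -lerBlDl.
apply: le_trans (le_excess C Bb); apply: lb_le_inf => [|_ [c Cc <-]].
  by have [c Cc] := hset_nonempty C; exists (mdist b c), c.
rewrite lerBlDl; apply: le_trans (setdist_le a Cc) _.
by apply: le_trans (metric_triangle a b c) _; rewrite lerD2r ltW.
Qed.

Let hausdorff_distxx A : hausdorff_dist A A = 0.
Proof. by rewrite /hausdorff_dist excessxx maxxx. Qed.

Let hausdorff_dist_positivity A B : hausdorff_dist A B = 0 -> A = B.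
Proof.
move=> AB0; apply: hyperspace_ext; apply/seteqP.
by split; apply: excess0; rewrite -AB0 le_max lexx ?orbT.
Qed.

Let hausdorff_dist_sym A B : hausdorff_dist A B = hausdorff_dist B A.
Proof. by rewrite /hausdorff_dist maxC. Qed.

Let hausdorff_dist_triangle B A C :
  hausdorff_dist A C <= hausdorff_dist A B + hausdorff_dist B C.
Proof.
rewrite ge_max; apply/andP; split.
  by apply: le_trans (excess_triangle B A C) _; rewrite lerD// le_max lexx.
apply: le_trans (excess_triangle B C A) _.
by rewrite addrC lerD// le_max lexx orbT.
Qed.

HB.instance Definition _ := @isMetric.Build R hyperspace hausdorff_dist
  hausdorff_distxx hausdorff_dist_positivity hausdorff_dist_sym
  hausdorff_dist_triangle.

Let image_closed (C : hyperspace) : closed (@tds_map R X @` C).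
Proof.
apply: (compact_closed (@metric_hausdorff R X)); apply: continuous_compact.
  exact/continuous_subspaceT/tds_continuous.
exact: subclosed_compact (hset_closed (h := C)) (@tds_compact R X) _.
Qed.

Let image_nonempty (C : hyperspace) : @tds_map R X @` C !=set0.
Proof. by have [c Cc] := hset_nonempty C; exists (tds_map c), c. Qed.

Definition hyperspace_map (C : hyperspace) : hyperspace :=
  Hyperspace (@image_closed C) (@image_nonempty C).

End hyperspace.

(** [measurableType]s are pointed: a point of X is chosen arbitrarily. *)
Definition pointed_space (R : realType) (X : tds R) : Type := X.

HB.instance Definition _ (R : realType) (X : tds R) :=
  Choice.on (pointed_space X).
HB.instance Definition _ (R : realType) (X : tds R) :=
  isPointed.Build (pointed_space X) (sval (cid (tds_nonempty X))).

Definition borel_space (R : realType) (X : tds R) :=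
  g_sigma_algebraType (@open X : set (set (pointed_space X))).

HB.instance Definition _ (R : realType) (X : tds R) :=
  Measurable.on (borel_space X).

Section borel_probability.
Context {R : realType} (X : tds R).

(** A [probability] is a function on all subsets, unconstrained outside the
    sigma-algebra; requiring the value 0 there makes equality of elements of
    M(X) coincide with equality of measures on Borel sets. *)
Record borel_probability := BorelProbability {
  bprob :> probability (borel_space X) R ;
  bprob_nonmeasurable :
    forall A : set (borel_space X), ~ measurable A -> bprob A = 0%E }.

HB.instance Definition _ := gen_eqMixin borel_probability.
HB.instance Definition _ := gen_choiceMixin borel_probability.

(** The weak* topology: the initial topology for the maps
    mu |-> \int f dmu, f ranging over the continuous functions X -> R. *)
Definition integral_against (mu : borel_probability) :
    {ptws continuousType X R -> R} :=
  fun f => Rintegral mu [set: borel_space X] f.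

Definition measure_space : Type := initial_topology integral_against.

HB.instance Definition _ := Topological.on measure_space.

Let T : borel_space X -> borel_space X := @tds_map R X.

Let measurable_T (A : set (borel_space X)) :
  measurable A -> measurable (T @^-1` A).
Proof.
move=> mA; rewrite -[X in measurable X]setTI.
suff : measurable_fun [set: borel_space X] T by exact.
apply: (@measurability _ _ _ _ _ T (@open X)) => //.
move=> _ [B oB <-]; rewrite setTI; apply: sub_sigma_algebra.
by move/continuousP: (@tds_continuous R X); exact.
Qed.

Section image_measure.
Variable mu : borel_probability.

Definition image_measure (A : set (borel_space X)) : \bar R :=
  if `[< measurable A >] then mu (T @^-1` A) else 0%E.

Let image_measure0 : image_measure set0 = 0%E.
Proof. by rewrite /image_measure asboolT// preimage_set0 measure0. Qed.

Let image_measure_ge0 A : (0 <= image_measure A)%E.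
Proof. by rewrite /image_measure; case: ifPn. Qed.

Let image_measure_sigma_additive : semi_sigma_additive image_measure.
Proof.
move=> F mF tF mUF; rewrite /image_measure asboolT//.
under eq_fun do under eq_bigr do rewrite asboolT//.
rewrite preimage_bigcup; apply: measure_semi_sigma_additive.
- by move=> n; exact: measurable_T.
- apply/trivIsetP => /= i j _ _ ij; rewrite -preimage_setI.
  by move/trivIsetP : tF => /(_ _ _ _ _ ij) ->//; rewrite preimage_set0.
- by rewrite -preimage_bigcup; exact: measurable_T.
Qed.

HB.instance Definition _ := isMeasure.Build _ _ _ image_measure
  image_measure0 image_measure_ge0 image_measure_sigma_additive.

Let image_measure1 : image_measure setT = 1%E.
Proof. by rewrite /image_measure asboolT// preimage_setT probability_setT. Qed.

HB.instance Definition _ :=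
  Measure_isProbability.Build _ _ _ image_measure image_measure1.

Let image_measure_nonmeasurable (A : set (borel_space X)) :
  ~ measurable A -> image_measure A = 0%E.
Proof. by move=> mA; rewrite /image_measure asboolF. Qed.

Definition image_probability : borel_probability :=
  @BorelProbability image_measure image_measure_nonmeasurable.

End image_measure.

Definition measure_space_map : measure_space -> measure_space :=
  image_probability.

End borel_probability.

(* Main.v *)
Require Import Defs.
From HB Require Import structures.
From mathcomp Require Import all_boot all_order all_algebra.
From mathcomp Require Import all_classical all_reals all_analysis.
From mathcomp Require Import measurable_realfun.

(** (1) Singletons transport weak mixing down from K(X), since the sets
    {C | C `<=` U}, U open, are open.  If J is a joining of X and a minimal Y,
    then {(C, y) | C meets the fibre of J over y} is a joining of K(X) and Y, so
    it is everything; evaluating it at singletons gives J = X * Y.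

    (2) Suppose that equivariant continuous maps phi_n from the powers X^n to Z
    have ranges with dense union.  The pullback of a joining of Z and a minimal
    Y along phi_n * id projects onto X^n, and also onto Y because its projection
    is closed and invariant; hence it is all of X^n * Y, so the joining contains
    the dense set of all (phi_n x, y).  For K(X), phi_n x is the set of
    coordinates of x; for M(X) it is the uniform measure on the coordinates. *)

Set Implicit Arguments.
Unset Strict Implicit.
Unset Printing Implicit Defensive.

Import Order.TTheory GRing.Theory Num.Theory.
Import numFieldNormedType.Exports.

Local Open Scope classical_set_scope.
Local Open Scope ring_scope.

(** * Product systems, minimality and the full joining *)

Lemma open_setX (X Y : topologicalType) (A : set X) (B : set Y) :
  open A -> open B -> open (A `*` B).
Proof.
move=> oA oB; rewrite openE => -[x y] [/= Ax By].
by exists (A, B) => //; split=> /=; apply: open_nbhs_nbhs.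
Qed.

Section dynamics.
Context {X Y : topologicalType} (T : X -> X) (S : Y -> Y).

Lemma iter_prod_map n (p : X * Y) :
  iter n (prod_map T S) p = (iter n T p.1, iter n S p.2).
Proof. by elim: n => [|n IHn] /=; [case: p|rewrite IHn]. Qed.

(** An invariant set contains the orbit of each of its points, and by minimality that orbit is
    dense. *)
Lemma minimal_invariant_closed (A : set X) : minimal_map T ->
  closed A -> A !=set0 -> T @` A `<=` A -> A = [set: X].
Proof.
move=> minT clA [x Ax] TA; apply/seteqP; split=> // y _.
have orbA n : A (iter n T x).
  by elim: n => //= n IHn; apply: TA; exists (iter n T x).
apply: clA => B /nbhs_interior By.
have [||z [Bz [n _ nz]]] := minT x B°.
- by exists y; exact: nbhs_singleton By.
- exact: open_interior.
by exists z; split; [rewrite -nz; exact: orbA|exact: interior_subset].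
Qed.

(** [disjoint_maps] is an equivalence; this settles its converse half. *)
Lemma joining_setT : [set: X] !=set0 -> [set: Y] !=set0 ->
  joining T S [set: X * Y].
Proof.
move=> [x _] [y _]; split=> //; first by exists (x, y).
- by apply/seteqP; split=> // z _; exists (z, y).
- by apply/seteqP; split=> // z _; exists (x, z).
Qed.

End dynamics.

(** * The Hausdorff metric, and descent from K(X) to X *)

Section hyperspace.
Context {R : realType} {X : tds R}.
Implicit Types (A B C D : hyperspace X) (x y : X).

(** Ensures that the suprema defining [excess] are taken over bounded sets, hence are genuine. *)
Lemma tds_mdist_bounded : exists M : R, forall x y, mdist x y <= M.
Proof.
have [p _] := tds_nonempty X.
(* Near covering swaps quantifiers: what holds near each [x] for all large [M] holds, for large [M],
   at all [x] at once. *)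
have /compact_near_coveringP/(_ R +oo%R (fun M x => mdist p x <= M) _) :=
  @tds_compact R X.
case=> [x _|M [_ pM]].
  near=> x' M => /=.
  apply: le_trans (metric_triangle p x x') _.
  apply: (@le_trans _ _ (mdist p x + 1)); last first.
    by near: M; apply: nbhs_pinfty_ge; rewrite num_real.
  rewrite lerD2l ltW//; near: x'.
  by have := nbhsx_ballx x _ (@ltr01 R); rewrite ballEmdist.
have {}pM x : mdist p x <= M + 1 by apply: pM => //; rewrite ltrDl.
exists (M + 1 + (M + 1)) => x y; apply: le_trans (metric_triangle x p y) _.
by rewrite lerD// metric_sym.
Unshelve. all: by end_near. Qed.

Lemma setdist_le x y (S : set X) : S y -> setdist x S <= mdist x y.
Proof.
move=> Sy; apply: ge_inf; last by exists y.
by exists 0 => _ [z _ <-]; exact: mdist_ge0.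
Qed.

Lemma hausdorff_dist_ltP A B e x : hausdorff_dist A B < e -> hset A x ->
  exists2 y, hset B y & mdist x y < e.
Proof.
rewrite gt_max => /andP[ABe _] Ax; have [M xyM] := tds_mdist_bounded.
have : setdist x B < e.
  apply: le_lt_trans ABe; apply: ub_le_sup; last by exists x.
  have [b Bb] := hset_nonempty B.
  by exists M => _ [a _ <-]; apply: le_trans (setdist_le a Bb) (xyM _ _).
move=> /inf_lt[|_ [y By <-] xye]; last by exists y.
by have [b Bb] := hset_nonempty B; exists (mdist x b), b.
Qed.

Lemma hausdorff_dist_le A B r :
  (forall x, hset A x -> exists2 y, hset B y & mdist x y <= r) ->
  (forall y, hset B y -> exists2 x, hset A x & mdist x y <= r) ->
  hausdorff_dist A B <= r.
Proof.
have excess_le (C D : hyperspace X) :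
    (forall x, hset C x -> exists2 y, hset D y & mdist x y <= r) ->
    excess C D <= r.
  move=> CDr; apply: ge_sup => [|_ [x /CDr[y Dy xyr] <-]].
    by have [c Cc] := hset_nonempty C; exists (setdist c D), c.
  exact: le_trans (setdist_le x Dy) xyr.
move=> ABr BAr; rewrite ge_max !excess_le// => y /BAr[x Ax].
by exists x; rewrite // metric_sym.
Qed.

(** Membership is a closed relation between X and K(X): if the [e]-ball at [x] misses [C], no set
    within [e / 2] of [C] meets the [e / 2]-ball at [x]. *)
Lemma near_notin_hyperspace x C : ~ hset C x ->
  \forall x' \near x & D \near C, ~ hset D x'.
Proof.
have := hset_closed (h := C); rewrite -openC openE => /[apply] /=.
rewrite /interior -nbhs_ballE => -[e /= e0 eC].
near=> x' D => Dx'.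
have [|y Cy x'y] := @hausdorff_dist_ltP D C (e / 2) x' _ Dx'.
  rewrite -[hausdorff_dist D C]/(mdist D C) metric_sym; near: D.
  by have := nbhsx_ballx C _ (divr_gt0 e0 (ltr0n _ 2)); rewrite ballEmdist.
suff /eC : ball x e y by [].
rewrite ballEmdist /= (splitr e); apply: le_lt_trans (metric_triangle x x' y) _.
apply: ltrD x'y; near: x'.
by have := nbhsx_ballx x _ (divr_gt0 e0 (ltr0n _ 2)); rewrite ballEmdist.
Unshelve. all: by end_near. Qed.

(** The implication [hset D x' -> U x'] holds for [x'] near [x] and [D] near [C]: through its
    conclusion if [x] lies in [C], through its failing premise otherwise. Compactness of X makes the
    neighbourhood of [C] uniform in [x]. *)
Lemma open_hyperspace_sub (U : set X) :
  open U -> open [set C : hyperspace X | C `<=` U].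
Proof.
move=> oU; rewrite openE => C /= CU.
have /compact_near_coveringP/(_ _ (nbhs C) (fun D x => hset D x -> U x) _)
  := @tds_compact R X.
have nearU x : [set: X] x -> \forall x' \near x & D \near C, hset D x' -> U x'.
  move=> _; have [Cx|/near_notin_hyperspace] := pselect (hset C x); last first.
    by apply: filterS => -[x' D] /=.
  have : \forall x' \near x & D \near C, U x'.
    by apply: cvg_fst; exact: (open_nbhs_nbhs (conj oU (CU _ Cx))).
  by apply: filterS => -[x' D].
by move/(_ nearU); apply: filterS => D DU x; exact: DU.
Qed.

Lemma range_closed_nonempty n (x : 'I_n.+1 -> X) :
  closed (range x) /\ range x !=set0.
Proof.
split; last by exists (x ord0), ord0.
have aX : accessible_space X.
  by apply: hausdorff_accessible; exact: (@metric_hausdorff R X).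
have [+ _] := @accessible_finite_set_closed X => /(_ aX); apply.
exact: finite_image.
Qed.

(** The map phi_n into K(X); the index type ['I_n.+1] keeps the set non-empty. *)
Definition hyperspace_range n (x : 'I_n.+1 -> X) : hyperspace X :=
  Hyperspace (range_closed_nonempty x).1 (range_closed_nonempty x).2.

Definition hyperspace_set1 x : hyperspace X := @hyperspace_range 0 (fun=> x).

Lemma iter_hyperspace_map n C :
  hset (iter n (@hyperspace_map R X) C) = iter n (@tds_map R X) @` C.
Proof.
elim: n => [|n IHn] /=; first by rewrite image_id.
by rewrite IHn image_comp.
Qed.

(** A box inside an open set of pairs of points lifts to the pairs of closed sets contained in its
    sides. A hitting time of the lifts is one of the original sets: follow any points of [C] and
    [D]. *)
Lemma weakly_mixing_of_hyperspace :
  weakly_mixing_map (@hyperspace_map R X) -> weakly_mixing_map (@tds_map R X).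
Proof.
have lift (W : set (X * X)) : open W -> W !=set0 ->
    exists W' : set (hyperspace X * hyperspace X), [/\ open W', W' !=set0 &
      forall p x y, W' p -> hset p.1 x -> hset p.2 y -> W (x, y)].
  move=> oW [[a b] /= Wab].
  have : nbhs (a, b) W by exact: (open_nbhs_nbhs (conj oW Wab)).
  move=> [[A B] [/= /nbhs_interior nA /nbhs_interior nB] ABW].
  exists ([set C | hset C `<=` A°] `*` [set C | hset C `<=` B°]); split.
  - by apply: open_setX; apply: open_hyperspace_sub; exact: open_interior.
  - exists (hyperspace_set1 a, hyperspace_set1 b); split=> /= _ [_ _ <-].
      exact: nbhs_singleton nA.
    exact: nbhs_singleton nB.
  - move=> [C D] x y /= [CA DB] Cx Dy; apply: ABW; split=> /=.
      exact: interior_subset (CA _ Cx).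
    exact: interior_subset (DB _ Dy).
move=> wmK U V oU /lift-/(_ oU)[U' [oU' U'0 U'U]].
move=> oV /lift-/(_ oV)[V' [oV' V'0 V'V]].
apply: sub_infinite_set (wmK _ _ oU' U'0 oV' V'0) => n /= [[C D]].
rewrite /= iter_prod_map => -[VCD UCD].
have [c Cc] := hset_nonempty C; have [d Dd] := hset_nonempty D.
exists (c, d); split; last exact: U'U UCD _ _.
rewrite /preimage/= iter_prod_map; apply: V'V VCD _ _.
- by rewrite iter_hyperspace_map; exists c.
- by rewrite iter_hyperspace_map; exists d.
Qed.

Lemma disjoint_from_minimal_of_hyperspace :
  disjoint_from_minimal R (@hyperspace_map R X) ->
  disjoint_from_minimal R (@tds_map R X).
Proof.
move=> djK Y minY J; split=> [|->]; last first.
  exact/joining_setT/tds_nonempty/tds_nonempty.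
move=> [J0 clJ TSJ J1 J2].
pose K := [set p : hyperspace X * Y | exists2 x, hset p.1 x & J (x, p.2)].
suff jK : joining (@hyperspace_map R X) (@tds_map R Y) K.
  apply/seteqP; split=> // -[x y] _.
  have : K (hyperspace_set1 x, y) by rewrite ((djK Y minY K).1 jK).
  by move=> [_ [_ _ <-]].
split.
- have [[x y] Jxy] := J0; exists (hyperspace_set1 x, y).
  by exists x => //; exists ord0.
(* Closedness of [K]: if [C] misses the fibre over [y], a point of [C] has a box around [(x, y)]
   avoiding [J], and a point off [C] stays off all nearby sets. Near covering over X combines the
   two cases. *)
- rewrite -openC openE => -[C y] /= nK.
  have nearJ x : [set: X] x ->
      \forall x' \near x & p \near (C, y), hset p.1 x' -> ~ J (x', p.2).
    move=> _; have [Cx|/near_notin_hyperspace nCx] := pselect (hset C x).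
      have : nbhs (x, y) (~` J).
        apply: open_nbhs_nbhs; split; first exact: closed_openC.
        by move=> Jxy; apply: nK; exists x.
      move=> [[A B] /= [xA yB] ABJ]; exists (A, [set p | B p.2]).
        by split=> //=; exact: (cvg_snd yB).
      move=> [x' [D y']] [/= Ax' By'] _.
      exact: ABJ (x', y') (conj Ax' By').
    move: nCx => [[A B] /= [xA CB] ABn]; exists (A, [set p | B p.1]).
      by split=> //=; exact: (cvg_fst CB).
    move=> [x' [D y']] [/= Ax' BD] Dx'.
    by have := ABn (x', D) (conj Ax' BD) Dx'.
  have /compact_near_coveringP/(_ _ (nbhs (C, y))
    (fun p x => hset p.1 x -> ~ J (x, p.2)) _ nearJ) := @tds_compact R X.
  by apply: filterS => -[D y'] /= DJ [x Dx Jxy']; exact: (DJ x).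
- move=> _ [[C y] [x Cx Jxy] <-]; exists (tds_map x); first by exists x.
  by apply: TSJ; exists (x, y).
- apply/seteqP; split=> // C _; have [c Cc] := hset_nonempty C.
  have : [set: X] c by []; rewrite -J1 => -[[x y] Jxy /= xc].
  by exists (C, y) => //; exists c => //; rewrite -xc.
- apply/seteqP; split=> // y _.
  have : [set: Y] y by []; rewrite -J2 => -[[x y'] Jxy /= y'y].
  exists (hyperspace_set1 x, y) => //.
  by exists x; rewrite -?y'y//; exists ord0.
Qed.

End hyperspace.

(** * Disjointness passed on from finite powers *)

(** The tube lemma: over a point [y] outside the projection, neighbourhoods avoiding [J] can be
    chosen uniformly along the compact factor. *)
Lemma closed_snd_image (X Y : topologicalType) (J : set (X * Y)) :
  compact [set: X] -> closed J -> closed (snd @` J).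
Proof.
move=> /compact_near_coveringP cX clJ; rewrite -openC openE => y nJy.
have nearJ x : [set: X] x -> \forall x' \near x & y' \near y, ~ J (x', y').
  move=> _; have : nbhs (x, y) (~` J).
    apply: open_nbhs_nbhs; split; first exact: closed_openC.
    by move=> Jxy; apply: nJy; exists (x, y).
  by apply: filterS => -[].
have := cX _ (nbhs y) (fun y' x => ~ J (x, y')) (nbhs_filter y) nearJ.
rewrite /interior; apply: filterS => y' nJ [[x z] Jxz /= zy].
by apply: (nJ x I); rewrite -zy.
Qed.

Lemma disjoint_from_minimal_dense_factors (R : realType)
    (X Z : topologicalType) (T : X -> X) (TZ : Z -> Z)
    (phi : forall n, {ptws 'I_n.+1 -> X} -> Z) :
  [set: X] !=set0 -> compact [set: X] -> (forall n, continuous (@phi n)) ->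
  (forall n x, phi n (power_map T x) = TZ (phi n x)) ->
  dense (\bigcup_n range (@phi n)) ->
  strongly_disjoint_from_minimal R T -> disjoint_from_minimal R TZ.
Proof.
move=> [x0 _] cX cphi phiT dphi sdT Y minY J; split=> [|->]; last first.
  by apply: joining_setT (tds_nonempty Y); exists (phi 0%N (fun=> x0)).
move=> [J0 clJ TSJ J1 J2].
have phiJ n x y : J (phi n x, y).
  pose K := [set p : {ptws 'I_n.+1 -> X} * Y | J (phi n p.1, p.2)].
  have KT : prod_map (@power_map X T n.+1) (@tds_map R Y) @` K `<=` K.
    move=> _ [[x' y'] Kxy <-]; rewrite /K/= phiT.
    by apply: TSJ; exists (phi n x', y').
  have clK : closed K.
    apply: (@closed_comp _ _ (fun p : {ptws 'I_n.+1 -> X} * Y =>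
      (phi n p.1, p.2))) => // -[x' y'] _.
    apply: cvg_pair => /=; last exact: cvg_snd.
    by apply: (@cvg_comp _ _ _ fst (@phi n)); [exact: cvg_fst|exact: cphi].
  have K1 : fst @` K = setT.
    apply/seteqP; split=> // x' _.
    have : [set: Z] (phi n x') by []; rewrite -J1 => -[[z y'] /= Jzy zE].
    by exists (x', y') => //; rewrite /K/= -zE.
  have Kx y' : exists x', K (x', y').
    suff : [set y' | exists x', K (x', y')] = setT by move=> /seteqP[_]; apply.
    apply: (minimal_invariant_closed minY).
    - have -> : [set y' | exists x', K (x', y')] = snd @` K.
        apply/seteqP; split=> [z [x' Kxz]|_ [[x' z] Kxz <-]]; last by exists x'.
        by exists (x', z).
      apply: closed_snd_image clK.
      (* The power is written as a product of full factors, so that Tychonoff gives its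
         compactness. *)
      rewrite (_ : setT = [set f : {ptws 'I_n.+1 -> X} | forall i, setT (f i)]).
        exact: (@tychonoff _ (fun=> X) (fun=> setT)).
      by apply/seteqP; split.
    - have : [set: {ptws 'I_n.+1 -> X}] x by []; rewrite -K1.
      by move=> [[x' z] Kxz _]; exists z, x'.
    - move=> _ [z [x' Kxz] <-]; exists (power_map T x').
      by apply: KT; exists (x', z).
  suff jK : joining (@power_map X T n.+1) (@tds_map R Y) K.
    have : K (x, y) by rewrite ((sdT n.+1 isT Y minY K).1 jK).
    by [].
  split=> //; first by have [x' Kxy] := Kx y; exists (x', y).
  by apply/seteqP; split=> // z _; have [x' Kxz] := Kx z; exists (x', z).
(* Density is needed in the first coordinate only: [y] itself serves in every box around
   [(z, y)]. *)
apply/seteqP; split=> // -[z y] _; apply: clJ => W [[A B] /= [zA yB] ABW].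
have [||z' [Az' [n _ [x _ xz']]]] := dphi A°.
- by exists z; exact: nbhs_singleton (nbhs_interior zA).
- exact: open_interior.
exists (z', y); split; first by rewrite -xz'; exact: phiJ.
by apply: ABW; split; [exact: interior_subset Az'|exact: nbhs_singleton yB].
Qed.

(** * Finite sets in K(X) *)

(** A finite intersection of neighbourhoods pulled back along the coordinate projections. *)
Lemma near_ptws (I : finType) (V : topologicalType) (x : {ptws I -> V})
    (P : I -> set V) :
  (forall i, nbhs (x i) (P i)) -> nbhs x [set y | forall i, P i (y i)].
Proof.
move=> xP; apply: (@filter_forall _ _ (fun i (y : {ptws I -> V}) => P i (y i))
  (nbhs x) (nbhs_filter x)).
by move=> i; exact: (@proj_continuous I (fun=> V) i x _ (xP i)).
Qed.

Section finite_sets.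
Context {R : realType} {X : tds R}.

Lemma finite_net (S : set X) (e : R) : compact S -> S !=set0 -> 0 < e ->
  exists n (x : 'I_n.+1 -> X), (forall i, S (x i)) /\
    forall y, S y -> exists i, mdist (x i) y < e.
Proof.
move=> cS [s0 Ss0] e0.
(* Near covering along the filter of finite subsets of S ordered by inclusion:
   [cover_compact] is only available for pointed spaces. *)
pose F : set_system (seq X) :=
  filter_from [set s : seq X | {in s, forall x, S x}]
    (fun s => [set t : seq X | {subset s <= t}]).
have FF : Filter F.
  apply: filter_from_filter; first by exists [::].
  move=> s t Ss St; exists (s ++ t) => [x|u /= stu].
    by rewrite mem_cat => /orP[/Ss|/St].
  by split=> x xst; apply: stu; rewrite mem_cat xst ?orbT.
have nearF x : S x -> \forall x' \near x & s \near F,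
    exists2 y, y \in s & mdist y x' < e.
  move=> Sx; exists (ball x e, [set s | x \in s]); last first.
    by move=> [x' s] /= [+ xs]; rewrite ballEmdist => xx'; exists x.
  split; first exact: nbhsx_ballx.
  exists [:: x] => [y|s /= xs]; first by rewrite inE => /eqP ->.
  by apply: xs; rewrite mem_head.
have /compact_near_coveringP/(_ _ F
  (fun s x => exists2 y, y \in s & mdist y x < e) FF nearF) := cS.
move=> [s /= Ss /(_ s (fun=> id)) sS].
(* A point of the net near [s0] shows that [s] is non-empty, so [(size s).-1.+1] is [size s] and
   [nth] never returns its default. *)
have [y0 y0s _] := sS _ Ss0.
have s_gt0 : (0 < size s)%N by case: (s) y0s.
exists (size s).-1, (fun i => nth s0 s i); split=> [i|y /sS[x xs xy]].
  by apply: Ss; apply: mem_nth; apply: leq_trans (ltn_ord i) _; rewrite prednK.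
have xs' : (index x s < (size s).-1.+1)%N by rewrite prednK// index_mem.
by exists (Ordinal xs'); rewrite nth_index.
Qed.

Lemma continuous_hyperspace_range n :
  continuous (fun x : {ptws 'I_n.+1 -> X} => hyperspace_range x).
Proof.
move=> x; apply/(@cvg_ballP _ _ _ (nbhs x)) => e e0.
(* Halving turns the non-strict bound of [hausdorff_dist_le] into membership in the open
   [e]-ball. *)
have e20 : 0 < e / 2 by rewrite divr_gt0.
have : nbhs x [set y | forall i, ball (x i) (e / 2) (y i)].
  apply: (@near_ptws _ X x (fun i => ball (x i) (e / 2))) => i.
  exact: nbhsx_ballx.
apply: (@filterS _ (nbhs x) (nbhs_filter (x : {ptws 'I_n.+1 -> X}))) => y xy.
rewrite ballEmdist /=.
apply: (@le_lt_trans _ _ (e / 2)).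
  apply: hausdorff_dist_le => _ [i _ <-].
    by exists (y i); [exists i|apply: ltW; have := xy i; rewrite ballEmdist].
  by exists (x i); [exists i|apply: ltW; have := xy i; rewrite ballEmdist].
by rewrite ltr_pdivrMr// ltr_pMr// ltr1n.
Qed.

(** A finite net of [C] chosen inside [C] is Hausdorff-close to [C]. *)
Lemma dense_hyperspace_range :
  dense (\bigcup_n range (@hyperspace_range R X n)).
Proof.
move=> U [C UC] oU.
have : nbhs C U by exact: open_nbhs_nbhs.
rewrite -nbhs_ballE => -[e /= e0 eU].
have e20 : 0 < e / 2 by rewrite divr_gt0.
have cC : compact (hset C).
  exact: subclosed_compact (hset_closed (h := C)) (@tds_compact R X) _.
have [n [x [Cx xC]]] := finite_net cC (hset_nonempty C) e20.
exists (hyperspace_range x); split; last by exists n => //; exists x.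
apply: eU; rewrite ballEmdist /=.
apply: (@le_lt_trans _ _ (e / 2)).
  apply: hausdorff_dist_le => y.
    move=> /xC[i xy]; exists (x i); first by exists i.
    by rewrite metric_sym ltW.
  by move=> [i _ <-]; exists (x i); rewrite ?mdistxx ?ltW.
by rewrite ltr_pdivrMr// ltr_pMr// ltr1n.
Qed.

Lemma disjoint_from_minimal_hyperspace :
  strongly_disjoint_from_minimal R (@tds_map R X) ->
  disjoint_from_minimal R (@hyperspace_map R X).
Proof.
apply: disjoint_from_minimal_dense_factors.
- exact: tds_nonempty.
- exact: tds_compact.
- exact: continuous_hyperspace_range.
- move=> n x; apply: hyperspace_ext => /=; apply/seteqP.
  split=> [_ [i _ <-]|_ [_ [i _ <-] <-]]; last by exists i.
  by exists (x i) => //; exists i.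
- exact: dense_hyperspace_range.
Qed.

End finite_sets.

(** * Uniform measures on finitely many points *)

Section probability_integrals.
Context {d : measure_display} {T : measurableType d} {R : realType}.
Implicit Types (P : probability T R) (f : T -> R).

Lemma integrable_bounded P f (M : R) : measurable_fun [set: T] f ->
  (forall y, `|f y| <= M) -> P.-integrable [set: T] (EFin \o f).
Proof.
move=> mf fM; apply: measurable_bounded_integrable => //.
  by apply: le_lt_trans (probability_le1 P measurableT) _; rewrite ltry.
exists M; split; first exact: num_real.
by move=> N MN y _; exact: le_trans (fM y) (ltW MN).
Qed.

Section empirical_measure.
Variables (n : nat) (x : 'I_n.+1 -> T).

(** [msum] takes a family indexed by [nat], whence [inord]. *)
Let avg : {measure set T -> \bar R} :=
  mscale (n.+1%:R^-1)%:nng (msum (fun k => dirac (x (inord k))) n.+1).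

(* The value 0 outside the sigma-algebra is the convention of
   [borel_probability]. *)
Definition empirical_measure (A : set T) : \bar R :=
  if `[< measurable A >] then avg A else 0%E.

Lemma empirical_measureE A : measurable A ->
  empirical_measure A = (n.+1%:R^-1 * \sum_(i < n.+1) \1_A (x i))%:E.
Proof.
move=> mA; rewrite /empirical_measure asboolT//.
rewrite /avg /= /mscale/= /msum EFinM -sumEFin; congr (_ * _)%E.
by apply: eq_bigr => i _; rewrite /dirac inord_val.
Qed.

Let empirical_measure0 : empirical_measure set0 = 0%E.
Proof. by rewrite /empirical_measure measure0; case: ifP. Qed.

Let empirical_measure_ge0 A : (0 <= empirical_measure A)%E.
Proof. by rewrite /empirical_measure; case: ifPn. Qed.

Let empirical_measure_sigma_additive : semi_sigma_additive empirical_measure.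
Proof.
move=> F mF tF mUF; rewrite /empirical_measure asboolT//.
under eq_fun do under eq_bigr do rewrite asboolT//.
exact: measure_semi_sigma_additive.
Qed.

HB.instance Definition _ := isMeasure.Build _ _ _ empirical_measure
  empirical_measure0 empirical_measure_ge0 empirical_measure_sigma_additive.

Let empirical_measure1 : empirical_measure setT = 1%E.
Proof.
rewrite empirical_measureE//; under eq_bigr do rewrite indicT.
by rewrite sumr_const card_ord mulVf.
Qed.

HB.instance Definition _ :=
  Measure_isProbability.Build _ _ _ empirical_measure empirical_measure1.

Lemma Rintegral_empirical_measure f : measurable_fun [set: T] f ->
  Rintegral empirical_measure [set: T] f = n.+1%:R^-1 * \sum_(i < n.+1) f (x i).
Proof.
move=> mf.
(* The integration formulas for [mscale] and [msum] are applied to non-negative functions; [f] is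
   then recovered from its positive and negative parts. *)
have avgf (g : T -> R) : measurable_fun [set: T] g -> (forall y, 0 <= g y) ->
    (\int[avg]_y (g y)%:E = (n.+1%:R^-1 * \sum_(i < n.+1) g (x i))%:E)%E.
  move=> mg g0; have mg' : measurable_fun [set: T] (EFin \o g).
    exact/measurable_EFinP.
  rewrite ge0_integral_mscale//; last by move=> y _; rewrite lee_fin.
  rewrite ge0_integral_measure_sum//; last by move=> y _; rewrite lee_fin.
  rewrite EFinM -sumEFin; congr (_ * _)%E; apply: eq_bigr => i _.
  by rewrite integral_dirac// diracT mul1e inord_val.
rewrite /Rintegral (eq_measure_integral avg); last first.
  by move=> A mA _; rewrite /= /empirical_measure asboolT.
rewrite integralE.
rewrite (eq_integral (fun y => (f^\+ y)%:E)); last first.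
  by move=> y _; rewrite -[RHS]/((EFin \o f^\+) y) -funerpos.
rewrite [X in (_ - X)%E](eq_integral (fun y => (f^\- y)%:E)); last first.
  by move=> y _; rewrite -[RHS]/((EFin \o f^\-) y) -funerneg.
rewrite !avgf; [|exact: measurable_funrneg|by move=> y; exact: funrneg_ge0
  |exact: measurable_funrpos|by move=> y; exact: funrpos_ge0].
rewrite -EFinB/= -mulrBr -sumrB; congr (_ * _); apply: eq_bigr => i _.
by rewrite -[in RHS](funrposBneg f).
Qed.

End empirical_measure.
End probability_integrals.

(** * Discretising weights and integrals *)

Lemma average_approx (R : archiRealFieldType) (T : Type) (m : nat)
    (a : 'I_m.+1 -> T) (w : 'I_m.+1 -> R) (e : R) :
  (forall k, 0 <= w k) -> \sum_k w k = 1 -> 0 < e ->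
  exists n (x : 'I_n.+1 -> T), forall (f : T -> R) M, (forall y, `|f y| <= M) ->
    `|\sum_k w k * f (a k) - n.+1%:R^-1 * \sum_(i < n.+1) f (x i)| <= M * e.
Proof.
(* Round each N * w k down to an integer t k; the N - \sum_k t k <= m.+1
   remaining points are all put at a 0. *)
move=> w0 w1 e0.
(* Rounding and padding each cost at most [D * M / N] with [D <= m.+1], so [N * e] must reach
   [2 * m.+1]. *)
pose N := (Num.truncn (2 * m.+1%:R / e)).+1.
have N0 : 0 < N%:R :> R by rewrite ltr0n.
have Ne : 2 * m.+1%:R <= N%:R * e.
  rewrite -ler_pdivrMr//; apply: ltW.
  have /truncn_itv/andP[] // : 0 <= 2 * m.+1%:R / e.
  by rewrite divr_ge0// ltW.
pose t k := Num.truncn (N%:R * w k).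
have /= tE k : (t k)%:R <= N%:R * w k < (t k).+1%:R.
  by apply: truncn_itv; rewrite mulr_ge0.
pose D := \sum_k (N%:R * w k - (t k)%:R).
have DE : D = N%:R - (\sum_k t k)%:R.
  by rewrite /D sumrB -mulr_sumr w1 mulr1 natr_sum.
have D0 : 0 <= D by apply: sumr_ge0 => k _; rewrite subr_ge0; case/andP: (tE k).
(* Makes the truncated subtraction in [s] an exact one. *)
have tN : (\sum_k t k <= N)%N by rewrite -(ler_nat R) -subr_ge0 -DE.
have Dm : D <= m.+1%:R.
  rewrite -[m.+1 in leRHS]card_ord -sum1_card natr_sum; apply: ler_sum => k _.
  by rewrite lerBlDr -natrD ltW//; case/andP: (tE k).
pose s := flatten [seq nseq (t k) (a k) | k <- enum 'I_m.+1] ++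
  nseq (N - \sum_k t k) (a ord0).
have sumsE (g : T -> R) :
    \sum_(y <- s) g y = \sum_k (t k)%:R * g (a k) + D * g (a ord0).
  rewrite big_cat/= big_flatten/= big_map big_enum/=; congr (_ + _).
    by apply: eq_bigr => k _; rewrite big_nseq iter_addr_0 mulr_natl.
  by rewrite big_nseq iter_addr_0 DE -natrB// mulr_natl.
have sN : size s = N.
  rewrite size_cat size_flatten /shape -map_comp sumnE big_map big_enum/=.
  by under eq_bigr do rewrite size_nseq; rewrite size_nseq subnKC.
exists N.-1, (fun i => nth (a ord0) s i) => f M fM.
have -> : \sum_(i < N.-1.+1) f (nth (a ord0) s i) = \sum_(y <- s) f y.
  by rewrite (big_nth (a ord0)) big_mkord sN.
rewrite sumsE -[N.-1.+1]/N.
(* After scaling by [N], the error is the sum of the [(N * w k - t k) * f (a k)] minus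
   [D * f (a ord0)]; each of the two terms is at most [D * M]. *)
rewrite -(ler_pM2l N0) -[X in X * `|_|]gtr0_norm// -normrM mulrBr.
rewrite mulVKf ?gt_eqF//.
rewrite mulr_sumr opprD addrA -sumrB.
apply: le_trans (ler_normB _ _) _.
apply: (@le_trans _ _ (D * M + D * M)).
  apply: lerD; last by rewrite normrM ger0_norm// ler_wpM2l.
  apply: le_trans (ler_norm_sum _ _ _) _; rewrite /D mulr_suml.
  apply: ler_sum => k _; rewrite mulrA -mulrBl normrM.
  by rewrite ger0_norm ?ler_wpM2l// subr_ge0; case/andP: (tE k).
have M0 : 0 <= M := le_trans (normr_ge0 _) (fM (a ord0)).
have -> : D * M + D * M = 2 * D * M by rewrite mulr_natl mulr2n mulrDl.
rewrite [leRHS]mulrCA [leRHS]mulrC ler_wpM2r//.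
by apply: le_trans Ne; rewrite ler_pM2l.
Qed.

Section riemann_sums.
Context {d : measure_display} {T : measurableType d} {R : realType}.

(** The sum is the integral of the step function [c \o p], which is uniformly [r]-close to [f], and
    [P] has mass 1. *)
Lemma dist_Rintegral_partition (P : probability T R) (m : nat) (p : T -> 'I_m)
    (c : 'I_m -> R) (f : T -> R) (r : R) :
  (forall k, measurable (p @^-1` [set k])) ->
  P.-integrable [set: T] (EFin \o f) ->
  (forall y, `|f y - c (p y)| <= r) ->
  `|Rintegral P [set: T] f - \sum_(k < m) fine (P (p @^-1` [set k])) * c k|
    <= r.
Proof.
move=> mp intf fcr.
pose g y := c (p y).
have gE y : (g y)%:E = (\sum_(k < m) (c k)%:E * (\1_(p @^-1` [set k]) y)%:E)%E.
  rewrite (bigD1 (p y))//= big1 ?adde0 ; last first.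
    move=> k kpy.
    by rewrite indicE memNset ?mule0// => /= pyk; rewrite pyk eqxx in kpy.
  by rewrite indicE mem_set// mule1.
have intk k : P.-integrable [set: T]
    (fun y => (c k)%:E * (\1_(p @^-1` [set k]) y)%:E)%E.
  by apply: integrableZl => //; exact: integrable_indic.
have intg : P.-integrable [set: T] (EFin \o g).
  rewrite (_ : EFin \o g = fun y =>
    (\sum_(k < m) (c k)%:E * (\1_(p @^-1` [set k]) y)%:E)%E); last exact/funext.
  exact: integrable_sum.
have -> : \sum_(k < m) fine (P (p @^-1` [set k])) * c k =
    Rintegral P [set: T] g.
  rewrite /Rintegral; under eq_integral do rewrite gE.
  rewrite integral_sum//.
  transitivity (fine (\sum_(k < m) (fine (P (p @^-1` [set k])) * c k)%:E)%E).
    by rewrite sumEFin.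
  congr fine; apply: eq_bigr => k _.
  rewrite integralZl//; last exact: integrable_indic.
  rewrite integral_indic// setIT EFinM muleC.
  congr (_ * _)%E.
  by rewrite (fineK (fin_num_measure P _ (mp k))).
have intfg : P.-integrable [set: T] (EFin \o (fun y => f y - g y)).
  by have := integrableB measurableT intf intg.
rewrite -RintegralB//; apply: le_trans (le_normr_Rintegral measurableT intfg) _.
have r1 : r = Rintegral P [set: T] (fun=> r).
  by rewrite Rintegral_cst// -[X in fine X]/(P [set: T]) probability_setT mulr1.
rewrite [leRHS]r1; apply: le_Rintegral => //.
- exact: integrable_norm intfg.
- exact: (@integrable_bounded _ _ _ P (fun=> r) `|r| (measurable_cst _)).
Qed.

End riemann_sums.

(** * Borel measures and weak* convergence *)

Section measure_space.
Context {R : realType} {X : tds R}.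
Local Notation Xb := (borel_space X).

Lemma borel_probability_ext (mu nu : borel_probability X) :
  (forall A, measurable A -> mu A = nu A) -> mu = nu.
Proof.
move=> munu.
have {munu} : bprob mu = bprob nu :> (set Xb -> \bar R).
  apply/funext => A; have [mA|nA] := pselect (measurable A); first exact: munu.
  by rewrite !bprob_nonmeasurable.
case: mu nu => [[m c] m0] [[m' c'] m'0] /= mm'; subst m'.
(* Over one underlying function, the two packed structures differ only in proofs. *)
have cc' : c = c'.
  case: c c' {m0 m'0} => [[a1 a2] [a3] [a4] [a5] [a6] [a7] [a8]].
  case=> [[b1 b2] [b3] [b4] [b5] [b6] [b7] [b8]].
  by rewrite (Prop_irrelevance b1 a1) (Prop_irrelevance b2 a2)
    (Prop_irrelevance b3 a3) (Prop_irrelevance b4 a4) (Prop_irrelevance b5 a5)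
    (Prop_irrelevance b6 a6) (Prop_irrelevance b7 a7) (Prop_irrelevance b8 a8).
by subst c'; congr BorelProbability; exact: Prop_irrelevance.
Qed.

Lemma measurable_tds_continuous (f : X -> R) : continuous f ->
  measurable_fun [set: Xb] (f : Xb -> R).
Proof.
move=> /continuousP cf.
apply: (measurability _ (RGenOpens.measurableE R)).
move=> _ [_ [a [b ->]] <-]; rewrite setTI; apply: sub_sigma_algebra.
by apply: cf; exact: interval_open.
Qed.

Lemma measurable_tds_map (A : set Xb) :
  measurable A -> measurable ((@tds_map R X : Xb -> Xb) @^-1` A).
Proof.
move=> mA; rewrite -[X in measurable X]setTI.
suff : measurable_fun [set: Xb] (@tds_map R X : Xb -> Xb) by exact.
apply: (@measurability _ _ _ _ _ (@tds_map R X : Xb -> Xb) (@open X)) => //.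
move=> _ [B oB <-]; rewrite setTI; apply: sub_sigma_algebra.
by move/continuousP: (@tds_continuous R X); exact.
Qed.

Lemma tds_continuous_bounded (f : X -> R) : continuous f ->
  exists M, forall y, `|f y| <= M.
Proof.
move=> cf; have : compact (f @` [set: X]).
  by apply: continuous_compact (@tds_compact R X); exact: continuous_subspaceT.
move=> /compact_bounded[M [_ fM]]; exists (M + 1) => y.
by apply: (fM (M + 1)); [rewrite ltrDl|exists y].
Qed.

(** Heine-Cantor, by near covering as [e] tends to 0 from the right. *)
Lemma tds_unif_continuous (f : X -> R) (r : R) : continuous f -> 0 < r ->
  exists2 e, 0 < e & forall x y, mdist x y < e -> `|f x - f y| <= r.
Proof.
move=> cf r0.
have r20 : 0 < r / 2 by rewrite divr_gt0.
have nearf x : [set: X] x -> \forall x' \near x & e \near (0 : R)^'+,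
    forall y, mdist x' y < e -> `|f x' - f y| <= r.
  move=> _; have := cf x; move=> /cvgrPdist_lt/(_ _ r20).
  rewrite -nbhs_ballE => -[e /= e0 ef].
  (* With these halves both [x'] and any [y] within [e'] of [x'] lie in the [e]-ball at [x]. *)
  exists (ball x (e / 2), [set e' | e' < e / 2]).
    split; first by apply: nbhsx_ballx; rewrite divr_gt0.
    by apply: nbhs_right_lt; rewrite divr_gt0.
  move=> [x' e'] /= [xx' e'e] y x'y.
  rewrite ballEmdist /= in xx'.
  have fx' : `|f x - f x'| < r / 2.
    apply: ef; rewrite ballEmdist /= (lt_le_trans xx')//.
    by rewrite ler_pdivrMr// ler_pMr// ler1n.
  have fy : `|f x - f y| < r / 2.
    apply: ef; rewrite ballEmdist /= (splitr e).
    apply: le_lt_trans (metric_triangle x x' y) _.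
    by rewrite ltrD// (lt_trans x'y).
  rewrite (splitr r); apply: le_trans (ler_distD (f x) _ _) _.
  by rewrite lerD// ltW// distrC.
have /compact_near_coveringP/(_ _ ((0 : R)^'+) (fun e x =>
    forall y, mdist x y < e -> `|f x - f y| <= r) _ nearf) := @tds_compact R X.
move=> near_f.
have : \forall e \near (0 : R)^'+, 0 < e /\ ([set: X] `<=` fun x =>
    forall y, mdist x y < e -> `|f x - f y| <= r).
  by near=> e; split; near: e; [exact: nbhs_right_gt|].
move=> /filter_ex[e [e0 fe]]; exists e => // x y; exact: fe.
Unshelve. all: by end_near. Qed.

(** The topology is initial for [integral_against], whose target carries pointwise convergence, so
    convergence is tested one [f] at a time. *)
Lemma cvg_measure_space (F : set_system (measure_space X))
    (mu : measure_space X) :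
  Filter F ->
  (forall f : continuousType X R,
    integral_against nu f @[nu --> F] --> integral_against mu f) ->
  F --> mu.
Proof.
move=> FF Fmu A [_ [[W oW <-] Wmu WA]].
have : @integral_against R X @ F --> integral_against mu.
  apply/cvg_sup => f B [_ [[V oV <-] Vmu VB]].
  have /Fmu : nbhs (integral_against mu f) V by exact: open_nbhs_nbhs.
  move=> FV; apply: (@filterS _ F FF _ _ _ FV) => nu; exact: VB.
move=> /(_ W) FW; apply: filterS WA _; apply: FW.
exact: open_nbhs_nbhs.
Qed.

End measure_space.

(** * Density of empirical measures in M(X) *)

Section empirical_measures.
Context {R : realType} {X : tds R}.
Local Notation Xb := (borel_space X).

Lemma measurable_metric_ball (a : X) (e : R) :
  measurable ([set y : X | mdist a y < e] : set Xb).
Proof.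
apply: sub_sigma_algebra; rewrite /= openE => y /= aye.
have e0 : 0 < e - mdist a y by rewrite subr_gt0.
apply: filterS (nbhsx_ballx y _ e0) => z; rewrite ballEmdist /= ltrBrDl.
exact: le_lt_trans (metric_triangle a y z).
Qed.

(** Each [y] is sent to the index of a ball of a finite net containing it. The choice depends only
    on the Boolean vector [b y] of balls containing [y], so each piece is a finite union of finite
    intersections of balls and their complements. *)
Lemma fine_measurable_partition (e : R) : 0 < e ->
  exists m (p : X -> 'I_m.+1) (a : 'I_m.+1 -> X),
    (forall k, measurable (p @^-1` [set k] : set Xb)) /\
    forall y, mdist (a (p y)) y < e.
Proof.
move=> e0.
have [m [a [_ aX]]] := finite_net (@tds_compact R X) (tds_nonempty X) e0.
pose b y := [ffun i => mdist (a i) y < e].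
(* The default [ord0] is never reached at a vector [b y], since the net covers X. *)
pose g (v : {ffun 'I_m.+1 -> bool}) := odflt ord0 [pick i | v i].
exists m, (g \o b), a; split=> [k|y]; last first.
  rewrite /= /g; case: pickP => [i|] /=; first by rewrite ffunE.
  by have [i aiy] := aX y I => /(_ i); rewrite ffunE aiy.
have -> : (g \o b) @^-1` [set k] =
    \bigcup_(v in [set v | g v = k]) \bigcap_(i in [set: 'I_m.+1])
      (if v i then [set y | mdist (a i) y < e]
       else ~` [set y | mdist (a i) y < e]).
  apply/seteqP; split=> [y <-|y [v <- vy]].
    exists (b y) => // i _; rewrite ffunE; case: ifP => //= /negbT.
    by move=> + h; rewrite h.
  congr g; apply/ffunP => i; rewrite ffunE.
  by have := vy i I; case: (v i) => //= /negP/negbTE.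
apply: fin_bigcup_measurable; first exact: finite_finset.
move=> v _; apply: fin_bigcap_measurable; first exact: finite_finset.
move=> i _; case: ifP => _; last apply: measurableC;
  exact: measurable_metric_ball.
Qed.

(** Closed by [Defined] so that it unfolds to [empirical_measure] by conversion. *)
Definition empirical_probability n (x : 'I_n.+1 -> X) : borel_probability X.
Proof.
apply: (@BorelProbability R X (@empirical_measure _ Xb R n x)) => A nA.
by rewrite /= /empirical_measure asboolF.
Defined.

Lemma integral_against_empirical n (x : 'I_n.+1 -> X) (f : continuousType X R) :
  integral_against (empirical_probability x) f =
  n.+1%:R^-1 * \sum_(i < n.+1) f (x i).
Proof.
rewrite -(@Rintegral_empirical_measure _ Xb R n x f)//.
by apply: measurable_tds_continuous; exact: cts_fun.
Qed.

Lemma measure_space_map_empirical n (x : 'I_n.+1 -> X) :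
  measure_space_map (empirical_probability x) =
  empirical_probability (fun i => tds_map (x i)).
Proof.
apply: borel_probability_ext => A mA.
rewrite /= /image_measure asboolT// !empirical_measureE//.
rewrite -[LHS]/(@empirical_measure _ Xb R n x (@tds_map R X @^-1` A)).
by rewrite empirical_measureE//; exact: measurable_tds_map.
Qed.

Lemma continuous_empirical n :
  continuous (fun x : {ptws 'I_n.+1 -> X} =>
    empirical_probability x : measure_space X).
Proof.
move=> x.
apply: (@cvg_measure_space _ _ _ _ (fmap_filter _ (nbhs_filter x))) => f.
apply/(@cvgrPdist_le _ _ _ _ (fmap_filter _ (nbhs_filter x))) => e e0.
have : nbhs x [set y | forall i, `|f (x i) - f (y i)| <= e].
  apply: (@near_ptws _ X x (fun i z => `|f (x i) - f z| <= e)) => i.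
  have cf : continuous f by exact: cts_fun.
  by have /cvgrPdist_le/(_ e e0) := cf (x i).
apply: (@filterS _ (nbhs x) (nbhs_filter x)) => y xy /=.
rewrite !integral_against_empirical -mulrBr -sumrB normrM ger0_norm//.
rewrite ler_pdivrMl//; apply: le_trans (ler_norm_sum _ _ _) _.
rewrite -[n.+1 in leRHS]card_ord -sumr_const mulr_suml; apply: ler_sum => i _.
by rewrite mul1r.
Qed.

(** The points [x] are chosen before [f], so one configuration serves all test functions. Passing to
    a Riemann sum on a fine partition costs [r]; replacing its weights by an average costs
    [M * e]. *)
Lemma empirical_approx (mu : borel_probability X) (e : R) : 0 < e ->
  exists n (x : 'I_n.+1 -> X), forall (f : continuousType X R) (r M : R),
    (forall y z, mdist y z < e -> `|f y - f z| <= r) ->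
    (forall y, `|f y| <= M) ->
    `|integral_against mu f - integral_against (empirical_probability x) f|
      <= r + M * e.
Proof.
move=> e0; have [m [p [a [mp ape]]]] := fine_measurable_partition e0.
pose w (k : 'I_m.+1) : R := fine (mu (p @^-1` [set k])).
have w0 k : 0 <= w k by rewrite fine_ge0.
have w1 : \sum_k w k = 1.
  (* The constant function 1 is its own Riemann sum. *)
  have := @dist_Rintegral_partition _ Xb R mu m.+1 p (fun=> 1) (fun=> 1) 0 mp.
  rewrite Rintegral_cst// -[X in fine X]/(mu [set: Xb]) probability_setT mulr1.
  under eq_bigr do rewrite mulr1.
  move=> w1; apply/esym/eqP; rewrite -subr_eq0 -normr_le0; apply: w1 => [|y].
    exact: (@integrable_bounded _ Xb R mu (fun=> 1) `|1| (measurable_cst _)).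
  by rewrite subrr normr0.
have [n [x xw]] := @average_approx R X m a w e w0 w1 e0.
exists n, x => f r M fr fM; rewrite integral_against_empirical.
apply: le_trans (ler_distD (\sum_k w k * f (a k)) _ _) _.
apply: lerD; last exact: xw.
apply: (@dist_Rintegral_partition _ Xb R mu m.+1 p (f \o a) f) => //.
- apply: (@integrable_bounded _ Xb R mu f M) => //.
  by apply: measurable_tds_continuous; exact: cts_fun.
- by move=> y; rewrite distrC; exact: fr.
Qed.

(** Empirical measures [nu k] approximating [mu] at scale [k.+1%:R^-1] for all [f] simultaneously
    form a sequence converging weak* to [mu], which therefore enters [U]. *)
Lemma dense_empirical : dense
  (\bigcup_n range (@empirical_probability n : _ -> measure_space X)).
Proof.
move=> U [mu Umu] oU.
have d0 k : 0 < k.+1%:R^-1 :> R by rewrite invr_gt0.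
pose P k (nu : measure_space X) :=
  (\bigcup_n range (@empirical_probability n : _ -> measure_space X)) nu /\
  forall (f : continuousType X R) (r M : R),
    (forall y z, mdist y z < k.+1%:R^-1 -> `|f y - f z| <= r) ->
    (forall y, `|f y| <= M) ->
    `|integral_against mu f - integral_against nu f| <= r + M * k.+1%:R^-1.
have /choice[nu nuP] k : exists nu, P k nu.
  have [n [x xmu]] := empirical_approx mu (d0 k).
  by exists (empirical_probability x); split=> //; exists n => //; exists x.
have nu_mu : nu @ \oo --> (mu : measure_space X).
  apply: cvg_measure_space => f; apply/cvgrPdist_le => e e0.
  have cf : continuous f by exact: cts_fun.
  have [M fM] := tds_continuous_bounded cf.
  have e20 : 0 < e / 2 by rewrite divr_gt0.
  have [d d_gt0 fd] := tds_unif_continuous cf e20.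
  have [y0 _] := tds_nonempty X.
  (* [M] may be 0, so [M + 1] is used as the divisor when choosing [k]. *)
  have M1 : 0 < M + 1 by rewrite ltr_wpDl// (le_trans _ (fM y0)).
  suff : \forall k \near \oo,
    `|integral_against mu f - integral_against (nu k) f| <= e by [].
  near=> k; rewrite [e]splitr.
  apply: (@le_trans _ _ (e / 2 + M * k.+1%:R^-1)).
    apply: (nuP k).2 _ _ _ _ fM => y z yz; apply: fd; apply: lt_trans yz _.
    by near: k; exact: near_infty_natSinv_lt (PosNum d_gt0).
  rewrite lerD2l.
  apply: (@le_trans _ _ ((M + 1) * k.+1%:R^-1)).
    by rewrite ler_wpM2r// lerDl.
  rewrite -ler_pdivlMl// mulrC ltW//; near: k.
  exact: near_infty_natSinv_lt (PosNum (divr_gt0 e20 M1)).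
have /nu_mu : nbhs (mu : measure_space X) U by exact: open_nbhs_nbhs.
move=> [N _ /(_ N (leqnn N)) UN].
by exists (nu N); split => //; exact: (nuP N).1.
Unshelve. all: by end_near. Qed.

Lemma disjoint_from_minimal_measure_space :
  strongly_disjoint_from_minimal R (@tds_map R X) ->
  disjoint_from_minimal R (@measure_space_map R X).
Proof.
apply: disjoint_from_minimal_dense_factors.
- exact: tds_nonempty.
- exact: tds_compact.
- exact: continuous_empirical.
- by move=> n x; rewrite measure_space_map_empirical.
- exact: dense_empirical.
Qed.

End empirical_measures.

Theorem theorem5p2 (R : realType) (X : tds R) :
  (weakly_mixing_map (@hyperspace_map R X) /\
   disjoint_from_minimal R (@hyperspace_map R X) ->
   weakly_mixing_map (@tds_map R X) /\
   disjoint_from_minimal R (@tds_map R X)) /\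
  (strongly_disjoint_from_minimal R (@tds_map R X) ->
   disjoint_from_minimal R (@hyperspace_map R X) /\
   disjoint_from_minimal R (@measure_space_map R X)).
Proof.
split=> [[wmK djK]|sdX]; split.
- exact: weakly_mixing_of_hyperspace.
- exact: disjoint_from_minimal_of_hyperspace.
- exact: disjoint_from_minimal_hyperspace.
- exact: disjoint_from_minimal_measure_space.
Qed.
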